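(* Let $R$ be a ring. The following conditions are equivalent: (a) $R$ is right self-injective. (b) $R$ is right dual Kasch and $E(R)$ is projective. Moreover, if $R$ is semilocal, then the following condition is also equivalent to (a) and (b): (c) $R$ is right dual Kasch and $E(R)$ is max-projective.
   Context: Rings are associative, unital and non-trivial; modules are unital right modules. $E(R)$ is the injective hull of $R$ as a right $R$-module. A ring $R$ is right dual Kasch if every simple right $R$-module is isomorphic to a factor module of an injective right $R$-module. $R$ is semilocal if $R/\mathrm{Jac}(R)$ is semisimple Artinian. A right $R$-module $M$ is max-projective if for every maximal right ideal $I$ of $R$, every homomorphism $M\to R/I$ factors through the canonical epimorphism $R\to R/I$. *)

(* Defs.v *)
From HB Require Import structures.
From mathcomp Require Import all_boot all_order all_algebra.
From mathcomp Require Import boolp.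

Set Implicit Arguments.
Unset Strict Implicit.
Unset Printing Implicit Defensive.

Import GRing.Theory.
Local Open Scope ring_scope.
Local Open Scope quotient_scope.

(* For [v : M], [M : rmodType R] and [a : R], the right action [v a] is
   [(a : R^c) *: v]; thus [((a * b : R) : R^c) *: v = b *: (a *: v)]. *)
Notation rmodType R := (lmodType R^c).

(* [a *: x] in [rreg R] is [x * a] in [R], so submodules of [rreg R] are right
   ideals. Beware that [*%R] on elements of type [rreg R] itself is the product
   of [R^c]. *)
Definition rreg (R : pzRingType) : rmodType R :=
  GRing.Lmodule.clone R^c (R^c)^o _.

Section SubmodulePred.
Variables (K : pzRingType) (V : lmodType K) (N : submodClosed V).

(* [Quotient.quot] expects a [zmodClosed] predicate, which [submodClosed] does
   not extend structurally, so closure under opposites is attached to a copy. *)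
Definition submod_pred : {pred V} := fun x => x \in N.

Fact submod_pred_zmod : zmod_closed submod_pred.
Proof. exact: GRing.submod_closedB (GRing.submodClosedP N). Qed.

HB.instance Definition _ := GRing.isZmodClosed.Build V submod_pred
  submod_pred_zmod.

End SubmodulePred.

HB.mixin Record isIdeal (R : pzRingType) (S : {pred R}) := {
  idealMl : forall a x : R, x \in S -> a * x \in S;
  idealMr : forall x a : R, x \in S -> x * a \in S
}.

#[short(type="ideal")]
HB.structure Definition Ideal (R : pzRingType) :=
  {S of GRing.ZmodClosed R S & isIdeal R S}.

Section QuotientModule.
Variables (K : pzRingType) (V : lmodType K) (N : submodClosed V).

Definition quotmod : Type := Quotient.quot (submod_pred N).
HB.instance Definition _ := GRing.Zmodule.on quotmod.

Definition quotmod_pi (x : V) : quotmod :=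
  \pi_(Quotient.quot (submod_pred N)) x.

Definition quotmod_scale (a : K) (u : quotmod) : quotmod :=
  quotmod_pi (a *: repr (u : Quotient.quot (submod_pred N))).

Lemma quotmod_eqP (x y : V) :
  reflect (quotmod_pi x = quotmod_pi y) (x - y \in N).
Proof.
by rewrite -[_ \in N]/(_ \in submod_pred N) Quotient.idealrBE; apply: eqP.
Qed.

Lemma quotmod_piB : {morph quotmod_pi : x y / x - y}.
Proof. exact: (raddfB (\pi_(Quotient.quot (submod_pred N)))). Qed.

Lemma quotmod_piD : {morph quotmod_pi : x y / x + y}.
Proof. exact: (raddfD (\pi_(Quotient.quot (submod_pred N)))). Qed.

Lemma quotmod_reprK (u : quotmod) : quotmod_pi (repr (u : Quotient.quot (submod_pred N))) = u.
Proof. exact: reprK. Qed.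

Lemma quotmod_piZ a x : quotmod_pi (a *: x) = quotmod_scale a (quotmod_pi x).
Proof.
apply/quotmod_eqP; rewrite -scalerBr rpredZ //.
by apply/quotmod_eqP; rewrite quotmod_reprK.
Qed.

Fact quotmod_scaleA a b u :
  quotmod_scale a (quotmod_scale b u) = quotmod_scale (a * b) u.
Proof. by rewrite -[u]quotmod_reprK -!quotmod_piZ scalerA. Qed.

Fact quotmod_scale1 : left_id 1 quotmod_scale.
Proof. by move=> u; rewrite -[u]quotmod_reprK -quotmod_piZ scale1r. Qed.

Fact quotmod_scaleDr : right_distributive quotmod_scale +%R.
Proof.
move=> a u v; rewrite -[u]quotmod_reprK -[v]quotmod_reprK -quotmod_piD.
by rewrite -!quotmod_piZ -quotmod_piD scalerDr.
Qed.

Fact quotmod_scaleDl u : {morph quotmod_scale^~ u : a b / a + b}.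
Proof.
move=> a b; rewrite -[u]quotmod_reprK.
by rewrite -!quotmod_piZ -quotmod_piD scalerDl.
Qed.

HB.instance Definition _ := GRing.Zmodule_isLmodule.Build K quotmod
  quotmod_scaleA quotmod_scale1 quotmod_scaleDr quotmod_scaleDl.

HB.instance Definition _ :=
  GRing.isZmodMorphism.Build V quotmod quotmod_pi quotmod_piB.
HB.instance Definition _ :=
  GRing.isScalable.Build K V quotmod *:%R quotmod_pi quotmod_piZ.

End QuotientModule.

Section QuotientRing.
Variables (R : pzRingType) (I : ideal R).

(* [Quotient.quot] already carries a ring structure in the commutative case, so
   the two-sided quotient lives on its own alias. *)
Definition quotring : Type := Quotient.quot I.
HB.instance Definition _ := GRing.Zmodule.on quotring.

Definition quotring_pi (x : R) : quotring := \pi_(Quotient.quot I) x.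

Definition quotring_mul (u v : quotring) : quotring :=
  quotring_pi (repr (u : Quotient.quot I) * repr (v : Quotient.quot I)).

Lemma quotring_eqP (x y : R) :
  reflect (quotring_pi x = quotring_pi y) (x - y \in I).
Proof. by rewrite Quotient.idealrBE; apply: eqP. Qed.

Lemma quotring_piB : {morph quotring_pi : x y / x - y}.
Proof. exact: (raddfB (\pi_(Quotient.quot I))). Qed.

Lemma quotring_piD : {morph quotring_pi : x y / x + y}.
Proof. exact: (raddfD (\pi_(Quotient.quot I))). Qed.

Lemma quotring_reprK (u : quotring) : quotring_pi (repr (u : Quotient.quot I)) = u.
Proof. exact: reprK. Qed.

Lemma quotring_piM x y :
  quotring_pi (x * y) = quotring_mul (quotring_pi x) (quotring_pi y).
Proof.
apply/quotring_eqP; set x' := repr _; set y' := repr _.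
have -> : x * y - x' * y' = (x - x') * y + x' * (y - y').
  by rewrite mulrBl mulrBr addrA subrK.
apply: rpredD; [apply: idealMr | apply: idealMl];
  by apply/quotring_eqP; rewrite quotring_reprK.
Qed.

Fact quotring_mulA : associative quotring_mul.
Proof.
move=> u v w; rewrite -[u]quotring_reprK -[v]quotring_reprK -[w]quotring_reprK.
by rewrite -!quotring_piM mulrA.
Qed.

Fact quotring_mul1l : left_id (quotring_pi 1) quotring_mul.
Proof. by move=> u; rewrite -[u]quotring_reprK -quotring_piM mul1r. Qed.

Fact quotring_mul1r : right_id (quotring_pi 1) quotring_mul.
Proof. by move=> u; rewrite -[u]quotring_reprK -quotring_piM mulr1. Qed.

Fact quotring_mulDl : left_distributive quotring_mul +%R.
Proof.
move=> u v w; rewrite -[u]quotring_reprK -[v]quotring_reprK -[w]quotring_reprK.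
by rewrite -quotring_piD -!quotring_piM -quotring_piD mulrDl.
Qed.

Fact quotring_mulDr : right_distributive quotring_mul +%R.
Proof.
move=> u v w; rewrite -[u]quotring_reprK -[v]quotring_reprK -[w]quotring_reprK.
by rewrite -quotring_piD -!quotring_piM -quotring_piD mulrDr.
Qed.

HB.instance Definition _ := GRing.Zmodule_isPzRing.Build quotring
  quotring_mulA quotring_mul1l quotring_mul1r quotring_mulDl quotring_mulDr.

HB.instance Definition _ :=
  GRing.isZmodMorphism.Build R quotring quotring_pi quotring_piB.
Fact quotring_pi_monoid : monoid_morphism quotring_pi.
Proof. by split=> // x y; rewrite quotring_piM. Qed.
HB.instance Definition _ :=
  GRing.isMonoidMorphism.Build R quotring quotring_pi quotring_pi_monoid.

End QuotientRing.

Section Modules.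
Variable K : pzRingType.
Implicit Types M A B E : lmodType K.

Definition surjective (T U : Type) (f : T -> U) : Prop :=
  forall y, exists x, f x = y.

Definition module_iso A B : Prop := exists f : {linear A -> B}, bijective f.

Definition is_factor_of A M : Prop :=
  exists N : submodClosed M, module_iso A (quotmod N).

Definition maximal_submodule M (N : submodClosed M) : Prop :=
  (exists x, x \notin N) /\
  forall L : submodClosed M, {subset N <= L} -> L =i N \/ L =i predT.

Definition simple_module M : Prop :=
  (exists x : M, x != 0) /\
  forall N : submodClosed M, N =i pred1 0 \/ N =i predT.

Definition simple_submodule M (N : submodClosed M) : Prop :=
  (exists2 x, x \in N & x != 0) /\
  forall L : submodClosed M, {subset L <= N} -> L =i pred1 0 \/ L =i N.

(* [M] is the sum of its simple submodules. *)
Definition semisimple_module M : Prop :=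
  forall x : M, exists (n : nat) (N : 'I_n -> submodClosed M) (y : 'I_n -> M),
    [/\ forall i, simple_submodule (N i), forall i, y i \in N i
      & x = \sum_i y i].

Definition artinian_module M : Prop :=
  forall N : nat -> submodClosed M, (forall n, {subset N n.+1 <= N n}) ->
  exists n, forall m, (n <= m)%N -> N m =i N n.

Definition injective_module M : Prop :=
  forall A B (i : {linear A -> B}) (f : {linear A -> M}), injective i ->
  exists g : {linear B -> M}, forall x, g (i x) = f x.

Definition projective_module M : Prop :=
  forall A B (p : {linear A -> B}) (f : {linear M -> B}), surjective p ->
  exists g : {linear M -> A}, forall x, p (g x) = f x.

Definition essential_map A B (i : {linear A -> B}) : Prop :=
  forall N : submodClosed B, (exists2 y, y \in N & y != 0) ->
  exists2 x : A, i x \in N & i x != 0.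

Definition injective_hull A E (i : {linear A -> E}) : Prop :=
  [/\ injective_module E, injective i & essential_map i].

End Modules.

Section Jacobson.
Variable R : pzRingType.

Definition jac : {pred R} :=
  fun x => `[< forall I : submodClosed (rreg R), maximal_submodule I -> x \in I >].

Lemma jacP x :
  reflect (forall I : submodClosed (rreg R), maximal_submodule I -> x \in I)
    (x \in jac).
Proof. exact: asboolP. Qed.

Fact jac_zmod_closed : zmod_closed jac.
Proof.
split=> [|x y /jacP Jx /jacP Jy]; apply/jacP => I maxI; first exact: rpred0.
exact: (rpredB (S := submod_pred I) (Jx _ maxI) (Jy _ maxI)).
Qed.

HB.instance Definition _ := GRing.isZmodClosed.Build R jac jac_zmod_closed.

Lemma right_ideal0 (I : submodClosed (rreg R)) : (0 : R) \in I.
Proof. exact: rpred0. Qed.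

Lemma right_idealD (I : submodClosed (rreg R)) (x y : R) :
  x \in I -> y \in I -> x + y \in I.
Proof. exact: rpredD. Qed.

Lemma right_idealM (I : submodClosed (rreg R)) (x a : R) :
  x \in I -> x * a \in I.
Proof. exact: (@rpredZ R^c (rreg R) I a). Qed.

Lemma right_ideal_of (S : {pred R}) :
    0 \in S -> (forall x y, x \in S -> y \in S -> x + y \in S) ->
    (forall x a, x \in S -> x * a \in S) ->
  exists I : submodClosed (rreg R), forall x : R, (x \in I) = (x \in S).
Proof.
move=> S0 SD SM.
have clS : submod_closed (S : {pred (rreg R)}).
  by split=> // a x y Sx Sy; apply: SD => //; apply: SM.
by exists (HB.pack_for (submodClosed (rreg R)) (S : {pred (rreg R)})
  (@GRing.isSubmodClosed.Build R^c (rreg R) S clS)).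
Qed.

Lemma maximal_preim (a : R) (I : submodClosed (rreg R)) :
  maximal_submodule I -> a \notin I ->
  exists2 J : submodClosed (rreg R),
    maximal_submodule J & forall x : R, (x \in J) = (a * x \in I).
Proof.
move=> [_ maxI] aI.
have [J defJ] : exists J : submodClosed (rreg R),
    forall x : R, (x \in J) = (a * x \in I).
  apply: (@right_ideal_of (fun x : R => a * x \in I)).
  - by rewrite unfold_in mulr0 right_ideal0.
  - by move=> x y; rewrite !unfold_in mulrDr; apply: right_idealD.
  - by move=> x b; rewrite !unfold_in mulrA; apply: right_idealM.
exists J => //; split; first by exists (1 : R); rewrite defJ mulr1.
move=> L sJL; have [[y yL yI]|noy] :=
    pselect (exists2 y : R, y \in L & a * y \notin I); last first.
  left=> y; apply/idP/idP => [yL|/sJL //]; rewrite defJ.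
  by apply/negPn/negP => yI; apply: noy; exists y.
right; suff L1 : (1 : R) \in L.
  by move=> x; have := right_idealM x L1; rewrite mul1r => ->.
have [P defP] : exists P : submodClosed (rreg R),
    forall z : R, (z \in P) =
      `[< exists2 u : R, u \in I & exists r, z = u + a * y * r >].
  apply: (@right_ideal_of (fun z : R =>
    `[< exists2 u : R, u \in I & exists r, z = u + a * y * r >])).
  - apply/asboolP; exists 0; first exact: right_ideal0.
    by exists 0; rewrite mulr0 addr0.
  - move=> _ _ /asboolP[u Iu [r ->]] /asboolP[v Iv [s ->]].
    apply/asboolP; exists (u + v); first exact: right_idealD.
    by exists (r + s); rewrite mulrDr addrACA.
  - move=> _ b /asboolP[u Iu [r ->]]; apply/asboolP.
    exists (u * b); first exact: right_idealM.
    by exists (r * b); rewrite mulrDl !mulrA.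
have sIP : {subset I <= P}.
  move=> z Iz; rewrite defP; apply/asboolP; exists z => //.
  by exists 0; rewrite mulr0 addr0.
have [PI|PT] := maxI P sIP.
  case/negP: yI; rewrite -PI defP; apply/asboolP.
  exists 0; first exact: right_ideal0.
  by exists 1; rewrite add0r mulr1.
have /asboolP[u Iu [r ar]] :
    `[< exists2 u : R, u \in I & exists r, a = u + a * y * r >].
  by rewrite -defP PT.
have J1 : (1 - y * r : R) \in L.
  by apply: sJL; rewrite defJ mulrBr mulr1 mulrA {1}ar addrK.
by have := right_idealD J1 (right_idealM r yL); rewrite subrK.
Qed.

Fact jac_Ml (a x : R) : x \in jac -> a * x \in jac.
Proof.
move=> /jacP Jx; apply/jacP => I maxI.
have [aI|aI] := boolP (a \in I); first exact: right_idealM.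
by have [J maxJ <-] := maximal_preim maxI aI; apply: Jx.
Qed.

Fact jac_Mr (x a : R) : x \in jac -> x * a \in jac.
Proof.
by move=> /jacP Jx; apply/jacP => I /Jx; apply: right_idealM.
Qed.

HB.instance Definition _ := isIdeal.Build R jac jac_Ml jac_Mr.

End Jacobson.

Arguments jac : clear implicits.

Section RingNotions.
Variable R : pzRingType.

Definition semisimple_artinian : Prop :=
  semisimple_module (rreg R) /\ artinian_module (rreg R).

Definition right_self_injective : Prop := injective_module (rreg R).

Definition right_dual_kasch : Prop :=
  forall S : rmodType R, simple_module S ->
  exists2 M : rmodType R, injective_module M & is_factor_of S M.

Definition max_projective (M : rmodType R) : Prop :=
  forall I : submodClosed (rreg R), maximal_submodule I ->
  forall f : {linear M -> quotmod I},
  exists g : {linear M -> rreg R}, forall x, f x = quotmod_pi I (g x).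

End RingNotions.

Definition semilocal (R : pzRingType) : Prop :=
  semisimple_artinian (quotring (jac R)).

(* Main.v *)
Require Import Defs.
From HB Require Import structures.
From mathcomp Require Import all_boot all_order all_algebra.
From mathcomp Require Import boolp classical_sets.

Set Implicit Arguments.
Unset Strict Implicit.
Unset Printing Implicit Defensive.

Import GRing.Theory.
Local Open Scope ring_scope.

(** The key is that right dual Kasch together with max-projectivity of the
    injective hull [E] makes [E] a generator.  If [I] is a maximal right ideal
    then [R/I] is simple, hence an image of an injective module [M]; a preimage
    in [M] of the class of [1] defines a map [R -> M], which extends to [E]
    because [M] is injective.  So there is a map [E -> R/I] sending [iota 1] to
    the class of [1], and max-projectivity lifts it to a map [E -> R] whose
    image is not contained in [I] ([max_projective_escapes_maximal]).  The trace
    of [E] in [R], the right ideal generated by the images of all maps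
    [E -> R], therefore lies in no maximal right ideal, and is [R] by Zorn's
    lemma.  Writing [1] as a finite sum of values [g_k e_k] exhibits [R] as a
    retract of a finite power of the injective module [E], so [R] is injective
    ([self_injective_of_trace]).

    Conversely, if [R] is injective then the essential embedding of [R] in [E]
    splits, hence is onto, so [E] is a free module of rank one; and every
    simple module, being cyclic, is a factor of the injective module [R].

    Projective modules are max-projective, so the first argument gives
    self-injectivity under either assumption on [E], and the second yields
    both kinds of projectivity of [E]. *)

(** * Submodules, factors and simple quotients *)

Section Modules.
Variable K : pzRingType.
Implicit Types A B M S : lmodType K.

Lemma linear_of A B (h : A -> B) :
  linear h -> exists g : {linear A -> B}, g =1 h.
Proof.
move=> hL.
by exists (HB.pack_for {linear A -> B} h
  (@GRing.isLinear.Build K A B *:%R h hL)).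
Qed.

Lemma submodule_of M (P : M -> Prop) :
    P 0 -> (forall a x y, P x -> P y -> P (a *: x + y)) ->
  exists N : submodClosed M, forall x, x \in N <-> P x.
Proof.
move=> P0 PL; pose S : {pred M} := fun x => `[< P x >].
have clS : submod_closed S.
  split=> [|a x y /asboolP Px /asboolP Py]; first exact/asboolP.
  exact/asboolP/PL.
exists (HB.pack_for (submodClosed M) S
  (@GRing.isSubmodClosed.Build K M S clS)) => x.
by split=> [/asboolP|Px]; last apply/asboolP.
Qed.

Lemma kernel_submodule A B (f : {linear A -> B}) :
  exists N : submodClosed A, forall x, x \in N <-> f x = 0.
Proof.
apply: submodule_of => [|a x y fx fy]; first exact: linear0.
by rewrite linearP fx fy scaler0 addr0.
Qed.

Lemma quotmod_pi_surj M (N : submodClosed M) : surjective (quotmod_pi N).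
Proof.
move=> u; exists (repr (u : Quotient.quot (submod_pred N))).
exact: quotmod_reprK.
Qed.

Lemma is_factor_ofP S M :
  is_factor_of S M <-> exists p : {linear M -> S}, surjective p.
Proof.
split=> [[N [f [g fK gK]]]|[p p_surj]].
  have gL : linear (g \o quotmod_pi N).
    by move=> a x y; apply: (can_inj fK); rewrite !linearP /= !gK linearP.
  have [p pE] := linear_of gL.
  exists p => s; have [x xE] := quotmod_pi_surj (f s).
  by exists x; rewrite pE /= xE fK.
have [N NP] := kernel_submodule p; exists N.
have /choice[s sK] : forall y, exists x, p x = y by exact: p_surj.
have piE x y : quotmod_pi N x = quotmod_pi N y <-> p x = p y.
  split=> [/quotmod_eqP/NP|pxy]; first by rewrite linearB => /subr0_eq.
  by apply/quotmod_eqP/NP; rewrite linearB /= pxy subrr.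
(* The choice of preimages is not linear, but it is so modulo the kernel. *)
have [f fE] : exists f : {linear S -> quotmod N}, f =1 quotmod_pi N \o s.
  apply: linear_of => a x y /=; rewrite -linearP.
  by apply/piE; rewrite linearP /= !sK.
exists f.
exists (fun u => p (repr (u : Quotient.quot (submod_pred N)))) => [x|u].
  by rewrite fE /= -[RHS]sK; apply/piE; exact: quotmod_reprK.
by rewrite fE /= -[RHS]quotmod_reprK; apply/piE; rewrite sK.
Qed.

Lemma quotmod_simple M (I : submodClosed M) :
  maximal_submodule I -> simple_module (quotmod I).
Proof.
move=> [[x xI] maxI]; split.
  exists (quotmod_pi I x); apply/eqP => x0; case/negP: xI.
  by rewrite -[x]subr0; apply/quotmod_eqP; rewrite x0 linear0.
move=> N.
have [L LP] : exists L : submodClosed M,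
    forall y, y \in L <-> quotmod_pi I y \in N.
  apply: submodule_of => [|a y z yN zN]; first by rewrite linear0 rpred0.
  by rewrite linearP rpredD // rpredZ.
have sIL : {subset I <= L}.
  move=> y yI; apply/LP; suff -> : quotmod_pi I y = 0 by exact: rpred0.
  by rewrite -(linear0 (quotmod_pi I)); apply/quotmod_eqP; rewrite subr0.
have [LI|LT] := maxI L sIL; [left|right] => u;
  have [y <-] := quotmod_pi_surj u.
  apply/idP/eqP => [/LP|->]; last exact: rpred0.
  rewrite LI => yI.
  by rewrite -(linear0 (quotmod_pi I)); apply/quotmod_eqP; rewrite subr0.
by rewrite inE; apply/LP; rewrite LT.
Qed.

(** Zorn's lemma applies because avoiding a single given element is inherited
    by unions of chains, unlike being proper. *)
Lemma maximal_avoiding M (N : submodClosed M) (x : M) : x \notin N ->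
  exists L : submodClosed M, [/\ {subset N <= L}, x \notin L &
    forall L' : submodClosed M, {subset L <= L'} -> x \notin L' -> L' =i L].
Proof.
move=> xN.
pose T := {L : submodClosed M | {subset N <= L} /\ x \notin L}.
pose leT (L L' : T) := `[< {subset sval L <= sval L'} >].
have N_T : {subset N <= N} /\ x \notin N by split.
have [||C C_tot|[L [sNL xL]] maxL] := @ZL_preorder T (exist _ N N_T) leT.
- by move=> L; apply/asboolP.
- move=> L2 L1 L3 /asboolP s12 /asboolP s23.
  by apply/asboolP => y /s12/s23.
- have [[L0 CL0]|C0] := pselect (exists L, C L); last first.
    by exists (exist _ N N_T) => L CL; case: C0; exists L.
  have [U UP] : exists U : submodClosed M,
      forall y, y \in U <-> exists2 L, C L & y \in sval L.
    apply: submodule_of => [|a y z [L CL yL] [L' CL' zL']].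
      by exists L0; last exact: rpred0.
    have [/asboolP LL'|/asboolP L'L] := C_tot L L' CL CL'.
      by exists L' => //; apply: rpredD => //; apply: rpredZ; exact: LL'.
    by exists L => //; apply: rpredD; [exact: rpredZ|exact: L'L].
  have U_T : {subset N <= U} /\ x \notin U.
    split=> [y yN|]; first by apply/UP; exists L0 => //; apply: (svalP L0).1.
    by apply/negP => /UP[L _]; apply/negP; case: (svalP L).
  by exists (exist _ U U_T) => L CL; apply/asboolP => y yL; apply/UP; exists L.
exists L; split=> // L' sLL' xL' y; apply/idP/idP; last exact: sLL'.
have L'_T : {subset N <= L'} /\ x \notin L' by split=> // z /sNL/sLL'.
have /asboolP := maxL (exist _ L' L'_T) (asboolT sLL').
exact.
Qed.

End Modules.

(** * Maps out of the regular module *)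

Section Ring.
Variable R : pzRingType.
Implicit Types M E S : rmodType R.

Lemma linear_from_ring M (m : M) :
  exists f : {linear rreg R -> M}, forall x : R, f x = (x : R^c) *: m.
Proof.
have [f fE] : exists f : {linear rreg R -> M}, f =1 (fun x : R^c => x *: m).
  by apply: linear_of => a x y; rewrite scalerDl scalerA.
by exists f.
Qed.

Lemma linear_from_ringE M (f : {linear rreg R -> M}) (x : R) :
  f x = (x : R^c) *: f (1 : R).
Proof. by rewrite -linearZ; congr (f _); exact: esym (mul1r x). Qed.

Lemma rreg_projective : projective_module (rreg R).
Proof.
move=> A B p f p_surj; have [a pa] := p_surj (f (1 : R)).
have [g gE] := linear_from_ring a.
by exists g => x; rewrite gE linearZ /= pa -linear_from_ringE.
Qed.

Lemma projective_max_projective M : projective_module M -> max_projective M.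
Proof.
move=> projM I _ f.
have [g gE] := projM _ _ (quotmod_pi I) f (@quotmod_pi_surj _ _ I).
by exists g => x; rewrite gE.
Qed.

Lemma right_ideal_full (I : submodClosed (rreg R)) :
  (1 : R) \in I -> I =i predT.
Proof.
move=> I1 x; have := right_idealM (x : R) I1.
by rewrite mul1r => ->.
Qed.

Lemma proper_right_ideal_sub_maximal (N : submodClosed (rreg R)) :
    (1 : R) \notin N ->
  exists2 I : submodClosed (rreg R), maximal_submodule I & {subset N <= I}.
Proof.
move=> /maximal_avoiding[I [sNI I1 maxI]]; exists I => //.
split=> [|L sIL]; first by exists (1 : R).
have [L1|L1] := boolP ((1 : R) \in L); last by left; exact: maxI.
by right; exact: right_ideal_full.
Qed.

(** Any nonzero element generates a simple module, so the map [R -> S] that it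
    defines is onto. *)
Lemma simple_factor_of_ring S : simple_module S -> is_factor_of S (rreg R).
Proof.
move=> [[x x0] simpleS]; apply/is_factor_ofP.
have [p pE] := linear_from_ring x; exists p.
have [N NP] : exists N : submodClosed S,
    forall y, y \in N <-> exists r : rreg R, p r = y.
  apply: submodule_of => [|a _ _ [r <-] [s <-]].
    by exists 0; exact: linear0.
  by exists (a *: r + s); rewrite linearP.
have [N0|NT] := simpleS N; last by move=> y; apply/NP; rewrite NT.
have : x \in N by apply/NP; exists (1 : R); rewrite pE scale1r.
by rewrite N0 inE (negPf x0).
Qed.

Lemma self_injective_right_dual_kasch :
  right_self_injective R -> right_dual_kasch R.
Proof. by move=> injR S /simple_factor_of_ring; exists (rreg R). Qed.

(** * Generators and self-injectivity *)

(** Multiplying by the [e_k] carries a map [A -> R] to maps [A -> E], which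
    extend; the [g_k] bring the extensions back, and their sum extends the
    original map because the [g_k e_k] add up to [1]. *)
Lemma self_injective_of_trace E (s : seq ({linear E -> rreg R} * E)) :
    injective_module E -> \sum_(c <- s) c.1 c.2 = (1 : R) ->
  right_self_injective R.
Proof.
move=> injE s1 A B i f i_inj.
have /choice[h hE] : forall c : {linear E -> rreg R} * E,
    exists h : {linear B -> E}, forall x, h (i x) = (f x : R^c) *: c.2.
  move=> c; have [m mE] := linear_from_ring c.2.
  have [h hE] := injE _ _ i (m \o f) i_inj.
  by exists h => x; rewrite hE /= mE.
have [g gE] : exists g : {linear B -> rreg R},
    forall y, g y = \sum_(c <- s) c.1 (h c y).
  apply: linear_of => a x y.
  rewrite scaler_sumr -big_split; apply: eq_bigr => c _.
  by rewrite !linearP.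
exists g => x; rewrite gE.
under eq_bigr do rewrite hE linearZ.
rewrite -scaler_sumr /= s1; exact: (mul1r (f x : R)).
Qed.

(** * Maps out of the injective hull of the ring *)

Section InjectiveHull.
Variables (E : rmodType R) (iota : {linear rreg R -> E}).
Hypothesis hE : injective_hull iota.

(** An injective module has no proper essential extension, so [iota] is an
    isomorphism, and [E] inherits projectivity from the regular module. *)
Lemma self_injective_hull_projective :
  right_self_injective R -> projective_module E.
Proof.
case: hE => _ iota_inj iota_ess injR.
have [r rK] := injR _ _ iota (idfun : {linear rreg R -> rreg R}) iota_inj.
(* The kernel of the retraction meets the image of [iota] trivially, so it
   vanishes by essentiality. *)
have r_inj y : r y = 0 -> y = 0.
  have [N NP] := kernel_submodule r; move=> ry0; apply/eqP/negPn/negP => y0.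
  have [|x /NP] := iota_ess N; first by exists y => //; apply/NP.
  by rewrite rK /= => ->; rewrite linear0 eqxx.
have iotaK y : iota (r y) = y.
  by apply/subr0_eq/r_inj; rewrite linearB /= rK subrr.
move=> A B p f p_surj.
have [g gE] := rreg_projective (f \o iota) p_surj.
by exists (g \o r) => y; rewrite /= gE /= iotaK.
Qed.

(** Injectivity of a module covering [R/I] makes the projection [R -> R/I]
    extend to [E]; the lift [g] of this extension sends [iota 1] into the coset
    [1 + I]. *)
Lemma max_projective_escapes_maximal (I : submodClosed (rreg R)) :
    right_dual_kasch R -> max_projective E -> maximal_submodule I ->
  exists (g : {linear E -> rreg R}) (e : E), g e \notin I.
Proof.
case: hE => _ iota_inj _ kaschR mpE maxI.
have [M injM /is_factor_ofP[p p_surj]] := kaschR _ (quotmod_simple maxI).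
have [m pm] := p_surj (quotmod_pi I (1 : R)).
have [j jE] := linear_from_ring m.
have [h hEj] := injM _ _ iota j iota_inj.
have [g gE] := mpE I maxI (p \o h).
exists g, (iota (1 : R)); apply/negP => gI.
have I1 : (1 : R) \in I.
  have : quotmod_pi I (g (iota (1 : R))) = quotmod_pi I (1 : R).
    by rewrite -gE /= hEj jE scale1r.
  move=> /esym/quotmod_eqP/(right_idealD gI).
  by rewrite addrC subrK.
by case: maxI => -[x]; rewrite (right_ideal_full I1).
Qed.

Lemma dual_kasch_max_projective_self_injective :
  right_dual_kasch R -> max_projective E -> right_self_injective R.
Proof.
move=> kaschR mpE.
(* [T] is the trace ideal of [E]. *)
have [T TP] : exists T : submodClosed (rreg R), forall x, x \in T <->
    exists s : seq ({linear E -> rreg R} * E), x = \sum_(c <- s) c.1 c.2.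
  apply: submodule_of => [|a _ _ [s ->] [t ->]].
    by exists [::]; rewrite big_nil.
  exists ([seq (c.1, a *: c.2) | c <- s] ++ t).
  rewrite big_cat big_map scaler_sumr /=; congr (_ + _).
  by apply: eq_bigr => c _; rewrite linearZ.
have [/TP[s s1]|T1] := boolP ((1 : R) \in T).
  by case: hE => injE _ _; exact: self_injective_of_trace injE (esym s1).
have [I maxI sTI] := proper_right_ideal_sub_maximal T1.
have [g [e /negP[]]] := max_projective_escapes_maximal kaschR mpE maxI.
by apply/sTI/TP; exists [:: (g, e)]; rewrite big_seq1.
Qed.

End InjectiveHull.
End Ring.

Theorem proposition2p13 (R : nzRingType) (E : rmodType R)
    (iota : {linear rreg R -> E}) (hE : injective_hull iota) :
  (right_self_injective R <-> right_dual_kasch R /\ projective_module E)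
  /\
  (semilocal R ->
    (right_self_injective R <-> right_dual_kasch R /\ max_projective E)).
Proof.
have ab : right_self_injective R -> right_dual_kasch R /\ projective_module E.
  move=> injR; split; first exact: self_injective_right_dual_kasch.
  exact: self_injective_hull_projective hE injR.
have ca : right_dual_kasch R -> max_projective E -> right_self_injective R.
  exact: dual_kasch_max_projective_self_injective hE.
split=> [|_]; split=> [injR|[kaschR]].
- exact: ab.
- by move/projective_max_projective; exact: ca.
- by have [kaschR /projective_max_projective] := ab injR.
- exact: ca.
Qed.
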